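(* Let $(S,+,\circ)$ be a dual weak brace. Then $$\operatorname{Soc}(S)=\{a\in S\mid \forall\, b\in S\quad a+b=a\circ b\ \text{ and }\ a+b=b+a\}$$ is an ideal of $S$.
   Context: A Clifford semigroup is an inverse semigroup with central idempotents. A weak brace is a triple $(S,+,\circ)$ such that $(S,+)$ and $(S,\circ)$ are inverse semigroups and, for all $a,b,c\in S$, $a\circ(b+c)=a\circ b-a+a\circ c$ and $a\circ a^-=-a+a$, where $-a$ and $a^-$ are the inverses of $a$ in $(S,+)$ and $(S,\circ)$ respectively, and $\circ$ has higher precedence than $+$. In a weak brace, $(S,+)$ is always a Clifford semigroup, and the idempotents of $(S,+)$ and $(S,\circ)$ coincide. A dual weak brace is a weak brace in which $(S,\circ)$ is a Clifford semigroup. For $a,b\in S$, $\lambda_a(b):=-a+a\circ b$. A subset $N$ of a Clifford semigroup $S$ (written multiplicatively, with $a^0=aa^{-1}=a^{-1}a$ and $E(S)$ the set of idempotents) is normal if: (1) $E(S)\subseteq N$; (2) $a\in N\Rightarrow a^{-1}\in N$; (3) $a,\ a^0b\in N\Rightarrow ab\in N$; (4) $ab\in N\Rightarrow ba\in N$, for all $a,b\in S$. An ideal of a dual weak brace $(S,+,\circ)$ is a subset $I\subseteq S$ such that $I$ is a normal subset of $(S,+)$, $\lambda_a(I)\subseteq I$ for every $a\in S$, and $I$ is a normal subset of $(S,\circ)$. *)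

(* Defs.v *)
From mathcomp Require Import all_boot.
From mathcomp Require Import classical_sets.

Set Implicit Arguments.
Unset Strict Implicit.
Unset Printing Implicit Defensive.

Local Open Scope classical_set_scope.

Section Semigroups.
Variables (S : Type) (op : S -> S -> S) (inv : S -> S).

Definition is_inverse (a b : S) : Prop :=
  op (op a b) a = a /\ op (op b a) b = b.

(* [inv] is determined by [op]: it picks out the unique inverse. *)
Record is_inverse_semigroup : Prop := IsInverseSemigroup {
  op_assoc : associative op;
  op_inv : forall a, unique (is_inverse a) (inv a)
}.

Definition idempotents : set S := [set e | op e e = e].

Record is_clifford : Prop := IsClifford {
  clifford_inverse :> is_inverse_semigroup;
  clifford_central : forall e a, idempotents e -> op e a = op a e
}.

Definition local_unit (a : S) : S := op a (inv a).

Record is_normal (N : set S) : Prop := IsNormal {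
  normal_idem : idempotents `<=` N;
  normal_inv : forall a, N a -> N (inv a);
  normal_op : forall a b, N a -> N (op (local_unit a) b) -> N (op a b);
  normal_comm : forall a b, N (op a b) -> N (op b a)
}.

End Semigroups.

Declare Scope brace_scope.
Delimit Scope brace_scope with brace.
Local Open Scope brace_scope.

Reserved Notation "a ∘ b" (at level 40, left associativity).

Record weakBrace : Type := WeakBrace {
  brace_sort :> Type;
  badd : brace_sort -> brace_sort -> brace_sort
    where "a + b" := (badd a b) : brace_scope;
  bopp : brace_sort -> brace_sort
    where "- a" := (bopp a) : brace_scope;
  bmul : brace_sort -> brace_sort -> brace_sort
    where "a ∘ b" := (bmul a b) : brace_scope;
  binv : brace_sort -> brace_sort;
  badd_inverse : is_inverse_semigroup badd bopp;
  bmul_inverse : is_inverse_semigroup bmul binv;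
  bmulDr : forall a b c : brace_sort, a ∘ (b + c) = a ∘ b + - a + a ∘ c;
  bmulV : forall a : brace_sort, a ∘ binv a = - a + a
}.

Notation "a + b" := (badd a b) : brace_scope.
Notation "- a" := (bopp a) : brace_scope.
Notation "a ∘ b" := (bmul a b) : brace_scope.

(* In a weak brace (S, +) is automatically a Clifford semigroup, so only
   (S, ∘) needs the extra condition. *)
Record dualWeakBrace : Type := DualWeakBrace {
  dual_brace :> weakBrace;
  bmul_clifford : is_clifford (@bmul dual_brace) (@binv dual_brace)
}.

Definition lambda (S : weakBrace) (a b : S) : S := - a + a ∘ b.

Record is_ideal (S : dualWeakBrace) (I : set S) : Prop := IsIdeal {
  ideal_add : is_normal (@badd S) (@bopp S) I;
  ideal_lambda : forall a : S, lambda a @` I `<=` I;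
  ideal_mul : is_normal (@bmul S) (@binv S) I
}.

Definition Soc (S : dualWeakBrace) : set S :=
  [set a | forall b : S, a + b = a ∘ b /\ a + b = b + a].

Arguments Soc S a : clear implicits.

(* Main.v *)
From mathcomp Require Import all_boot.
From mathcomp Require Import classical_sets.
Require Import Defs.

(** The semigroups [(S, +)] and [(S, ∘)] have the same idempotents, these are
central for both operations, and [e + b = e ∘ b] whenever [e] is idempotent; so
each [a] has a single local unit [a⁰ = a - a = a ∘ a⁻].  Up to local units
one then argues as in a skew brace: the elements of the socle are central for
[+] and act trivially through [lambda], so that for [z] in [Soc S] one has
[lambda a z = a ∘ z ∘ a⁻], which gives both the invariance under [lambda] and
the normality in [(S, ∘)]. *)

Set Implicit Arguments.
Unset Strict Implicit.
Unset Printing Implicit Defensive.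

Local Open Scope classical_set_scope.

(** * Inverse semigroups: idempotents, and a criterion for being Clifford *)

Section InverseSemigroup.
Variables (S : Type) (op : S -> S -> S) (inv : S -> S).
Local Infix "*" := op.
Hypothesis invS : is_inverse_semigroup op inv.

Let opA : associative op := op_assoc invS.

Lemma mulVK a : a * inv a * a = a.
Proof. by case: (op_inv invS a) => -[]. Qed.

Lemma mulKV a : inv a * a * inv a = inv a.
Proof. by case: (op_inv invS a) => -[]. Qed.

Lemma inv_unique a b : a * b * a = a -> b * a * b = b -> inv a = b.
Proof. by move=> aba bab; case: (op_inv invS a) => _; apply. Qed.

Lemma inv_inv a : inv (inv a) = a.
Proof. by apply: inv_unique; rewrite ?mulKV ?mulVK. Qed.

Lemma inv_idem e : e * e = e -> inv e = e.
Proof. by move=> ee; apply: inv_unique; rewrite !ee. Qed.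

Lemma idem_divr a : (a * inv a) * (a * inv a) = a * inv a.
Proof. by rewrite opA mulVK. Qed.

Lemma idem_divl a : (inv a * a) * (inv a * a) = inv a * a.
Proof. by rewrite opA mulKV. Qed.

Lemma idem_mul e f : e * e = e -> f * f = f -> (e * f) * (e * f) = e * f.
Proof.
move=> ee ff; set x := inv (e * f).
have xefx : x * e * f * x = x by rewrite -[RHS]mulKV !opA.
have efxef : e * f * x * e * f = e * f by rewrite -[RHS]mulVK !opA.
(* [f * x * e] is also an inverse of [e * f], so uniqueness gives [x = f * x * e]. Hence [x] is
   idempotent, and so is its inverse [e * f]. *)
have xE : x = f * x * e.
  apply: inv_unique; rewrite !opA.
    by rewrite -(opA e f f) ff -(opA _ e e) ee efxef.
  rewrite -(opA _ e e) ee -(opA _ f f) ff.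
  by rewrite -!(opA f) xefx.
have xx : x * x = x.
  rewrite {1 2}xE !opA -(opA f x e) -(opA f) -(opA f).
  by rewrite xefx -xE.
by rewrite -(inv_inv (e * f)) -/x (inv_idem xx) xx.
Qed.

Lemma idemC e f : e * e = e -> f * f = f -> e * f = f * e.
Proof.
move=> ee ff.
have efef := idem_mul ee ff; have fefe := idem_mul ff ee.
(* The idempotent [e * f] is its own inverse, and [f * e] is an inverse of it too. *)
rewrite -(inv_idem efef); apply: inv_unique; rewrite !opA.
  by rewrite -(opA e f f) ff -(opA _ e e) ee -(opA _ e f).
by rewrite -(opA f e e) ee -(opA _ f f) ff -(opA _ f e).
Qed.

Lemma inv_mul_idem a e : e * e = e -> inv (a * e) = e * inv a.
Proof.
move=> ee; have C := idemC ee (idem_divl a).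
apply: inv_unique; rewrite !opA.
  rewrite -(opA a e e) ee -(opA a) -(opA a) -(opA e) C.
  by rewrite !opA mulVK -(opA a) ee.
by rewrite -(opA _ e e) ee -(opA e (inv a) a) -(opA e _ e) -C (opA e e) ee
  -opA mulKV.
Qed.

Lemma divC_clifford : (forall a, a * inv a = inv a * a) -> is_clifford op inv.
Proof.
move=> divC; split=> // e a; rewrite /idempotents /= => ee.
have C := idemC ee (idem_divl a).
(* The hypothesis at [a * e] yields [a * e * inv a = e * (inv a * a)]; multiplying by [a] on the
   right gives centrality of [e]. *)
have := divC (a * e); rewrite inv_mul_idem // => H.
have {}H : a * e * inv a = e * (inv a * a).
  have -> : a * e * inv a = a * e * (e * inv a).
    by rewrite opA -(opA a e e) ee.
  by rewrite H -opA (opA (inv a)) -C (opA e e) ee.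
have aVaK : a * (inv a * a) = a by rewrite opA mulVK.
transitivity (e * (inv a * a) * a); first by rewrite -opA -divC mulVK.
by rewrite -H -opA -opA C opA aVaK.
Qed.
End InverseSemigroup.

(** * Clifford semigroups: calculus of local units *)

Section CliffordSemigroup.
Variables (S : Type) (op : S -> S -> S) (inv : S -> S).
Local Infix "*" := op.
Local Notation unit := (local_unit op inv).
Hypothesis cliffS : is_clifford op inv.

Let invS : is_inverse_semigroup op inv := cliffS.
Let opA : associative op := op_assoc invS.

Lemma local_unit_idem a : unit a * unit a = unit a.
Proof. exact: (idem_divr invS). Qed.

Lemma local_unitC a b : unit a * b = b * unit a.
Proof. by apply: (clifford_central cliffS); exact: local_unit_idem. Qed.

Lemma local_unitK a : unit a * a = a.
Proof. exact: (mulVK invS). Qed.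

Lemma mulVl a : inv a * a = unit a.
Proof.
have VaC b : inv a * a * b = b * (inv a * a).
  by apply: (clifford_central cliffS); exact: (idem_divl invS).
have aVE : inv a = inv a * (inv a * a) by rewrite -VaC (mulKV invS).
have aE : a = a * unit a by rewrite -local_unitC local_unitK.
by rewrite /local_unit {2}aVE opA -/(unit a) -VaC -opA -aE.
Qed.

Lemma local_unit_inv a : unit (inv a) = unit a.
Proof. by rewrite {1}/local_unit (inv_inv invS) mulVl. Qed.

Lemma local_unitKV a : unit a * inv a = inv a.
Proof. by rewrite -{1}local_unit_inv local_unitK. Qed.
End CliffordSemigroup.

Local Open Scope brace_scope.

(** * Weak braces: common idempotents and the Clifford property of [+] *)

Section WeakBrace.
Variable S : weakBrace.
Implicit Types a b c e f : S.

Let addI : is_inverse_semigroup (@badd S) (@bopp S) := badd_inverse S.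
Let mulI : is_inverse_semigroup (@bmul S) (@binv S) := bmul_inverse S.
Let addA : associative (@badd S) := op_assoc addI.

Lemma idem_add_of_mul e : e ∘ e = e -> e + e = e.
Proof.
move=> ee; have := bmulV e; rewrite (inv_idem mulI ee) ee => ->.
exact: (idem_divl addI).
Qed.

Lemma idem_mul_of_add e : e + e = e -> e ∘ e = e.
Proof.
move=> ee; have := bmulV e; rewrite (inv_idem addI ee) ee => <-.
exact: (idem_divr mulI).
Qed.

Lemma bmulDr_idem e a b : e + e = e -> e ∘ (a + b) = e ∘ a + e + e ∘ b.
Proof. by move=> ee; rewrite bmulDr (inv_idem addI ee). Qed.

(** Expanding [f ∘ (e + e)] gives [f ∘ e + f = f ∘ e]; expanding [f ∘ (e + f)] then gives
    [f = f ∘ e]. *)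
Lemma idem_mul_le e f : e + e = e -> f + f = f -> e + f = f -> e ∘ f = f.
Proof.
move=> ee ff ef.
have C := idemC mulI (idem_mul_of_add ee) (idem_mul_of_add ff).
have idem_fe : f ∘ e + f ∘ e = f ∘ e.
  exact/idem_add_of_mul/(idem_mul mulI)/idem_mul_of_add/ee/idem_mul_of_add/ff.
have fe_le : f ∘ e + f = f ∘ e.
  have := bmulDr_idem e e ff; rewrite ee => {2}->.
  by rewrite -(idemC addI ff idem_fe) -addA idem_fe.
by have := bmulDr_idem e f ff; rewrite ef (idem_mul_of_add ff) !fe_le -C.
Qed.

(** The axiom [bmulV] identifies only [- b + b] with [b ∘ binv b], so the two sides differ: on the
    right [e] fixes [- b + b], while on the left one expands [e ∘ (g + b)] and shows that [e ∘ g]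
    absorbs [e]. *)
Lemma idem_mul_fix e b : e + e = e -> e ∘ b = b -> b + e = b /\ e + b = b.
Proof.
move=> ee eb; pose f := - b + b; pose g := b + - b.
have ff : f + f = f by exact: (idem_divl addI).
have gg : g + g = g by exact: (idem_divr addI).
have ef : e ∘ f = f by rewrite /f -bmulV (op_assoc mulI) eb.
have fe : f + e = f.
  have := bmulDr_idem f f ee; rewrite ff ef => {2}->.
  by rewrite -addA (idemC addI ee ff) addA ff.
have be : b + e = b.
  by rewrite -{1}(mulVK addI b) -[b + - b + b]addA -addA fe addA (mulVK addI).
split=> //.
have idem_eg : e ∘ g + e ∘ g = e ∘ g.
  exact/idem_add_of_mul/(idem_mul mulI)/idem_mul_of_add/gg/idem_mul_of_add/ee.
have eg : e + e ∘ g = e ∘ g.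
  have := bmulDr_idem g g ee; rewrite gg => {2}->.
  by rewrite (idemC addI idem_eg ee) -addA idem_eg.
have egb : b = e ∘ g + b.
  have := bmulDr_idem g b ee; rewrite (mulVK addI) eb => {1}->.
  by rewrite (idemC addI idem_eg ee) eg.
by rewrite egb addA eg.
Qed.

Lemma badd_clifford : is_clifford (@badd S) (@bopp S).
Proof.
apply: divC_clifford => // a.
(* In the order on idempotents, [c + - c] lies below [- c + c], because [- c + c = c ∘ binv c] fixes
   [c]. Taking [c] to be [a] and then [- a] gives equality. *)
have le c : - c + c + (c + - c) = c + - c.
  rewrite addA; congr (_ + _).
  apply: (proj2 (idem_mul_fix (idem_divl addI c) _)).
  by rewrite -bmulV (mulVK mulI).
rewrite -(le a) (idemC addI (idem_divl addI a) (idem_divr addI a)).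
by have := le (- a); rewrite (inv_inv addI).
Qed.

Local Notation "a ⁰" := (local_unit (@badd S) (@bopp S) a)
  (at level 2, format "a ⁰").

Lemma bmul_div a : a ∘ binv a = a⁰.
Proof. by rewrite bmulV (mulVl badd_clifford). Qed.

Lemma bmul_idem e b : e + e = e -> e ∘ b = e + b.
Proof.
move=> ee.
have fixeb : e ∘ (e ∘ b) = e ∘ b.
  by rewrite (op_assoc mulI) (idem_mul_of_add ee).
have [_ eb] := idem_mul_fix ee fixeb.
set y := e + b.
(* It remains to see that [e] fixes [y] for [∘]; as [y⁰ ∘ y = y], it suffices that it fixes the
   idempotent [y⁰]. *)
have -> : e ∘ b = e ∘ y by rewrite bmulDr_idem // (idem_mul_of_add ee) ee eb.
have yy := local_unit_idem badd_clifford y.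
have ey : e ∘ y⁰ = y⁰.
  by apply: idem_mul_le => //; rewrite /local_unit addA /y [in LHS]addA ee.
have yK : y⁰ ∘ y = y by rewrite -bmul_div (mulVK mulI).
by rewrite -{1}yK (op_assoc mulI) ey yK.
Qed.

Lemma lambda_bmul a b : lambda a b = a ∘ (binv a + b).
Proof. by rewrite bmulDr bmulV -addA addA (mulKV addI). Qed.

Lemma lambdaD a b c : lambda a (b + c) = lambda a b + lambda a c.
Proof. by rewrite /lambda bmulDr !addA. Qed.
End WeakBrace.

(** * The socle: closure properties *)

Section Socle.
Variable S : dualWeakBrace.
Implicit Types a b c e z : S.

Local Notation "a ⁰" := (local_unit (@badd S) (@bopp S) a)
  (at level 2, format "a ⁰").

Let mulC : is_clifford (@bmul S) (@binv S) := bmul_clifford S.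
Let addC : is_clifford (@badd S) (@bopp S) := badd_clifford S.
Let addI : is_inverse_semigroup (@badd S) (@bopp S) := addC.
Let mulI : is_inverse_semigroup (@bmul S) (@binv S) := mulC.
Let addA : associative (@badd S) := op_assoc addI.
Let mulA : associative (@bmul S) := op_assoc mulI.

Lemma bmul_unit a b : a⁰ ∘ b = a⁰ + b.
Proof. exact: (bmul_idem _ (local_unit_idem addC a)). Qed.

Lemma binv_unit a : (binv a)⁰ = a⁰.
Proof. by rewrite -!bmul_div; exact: (local_unit_inv mulC). Qed.

Lemma bmulVl a : binv a ∘ a = a⁰.
Proof. by rewrite (mulVl mulC) -bmul_div. Qed.

Lemma bmulUK a b : a ∘ (a⁰ + b) = a ∘ b.
Proof.
rewrite -bmul_unit mulA; congr (_ ∘ b).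
by rewrite -bmul_div -(local_unitC mulC a a) (local_unitK mulC).
Qed.

Lemma soc_idem e : e + e = e -> Soc S e.
Proof.
move=> ee b; split; first by rewrite bmul_idem.
exact: (clifford_central addC).
Qed.

Lemma soc_add a b : Soc S a -> Soc S b -> Soc S (a + b).
Proof.
move=> sa sb c.
have cA x : a + x = x + a by case: (sa x).
have cB x : b + x = x + b by case: (sb x).
split; last by rewrite -addA cB addA cA -addA.
rewrite [in RHS](proj1 (sa b)) -mulA -(proj1 (sb c)) -(proj1 (sa _)).
by rewrite addA.
Qed.

(** In the socle [a ∘ - a = a + - a = a⁰], and [binv a] cancels [a] on the left. *)
Lemma soc_binv a : Soc S a -> binv a = - a.
Proof.
move=> sa; transitivity (binv a ∘ (a ∘ - a)).
  rewrite -(proj1 (sa _)) -/(a⁰) -bmul_div -(local_unitC mulC a).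
  by rewrite (local_unitKV mulC).
by rewrite mulA bmulVl bmul_unit (local_unitKV addC).
Qed.

Lemma soc_opp a : Soc S a -> Soc S (- a).
Proof.
move=> sa b; split.
  (* Here [a⁰ + b = a + (- a + b) = a ∘ (- a + b)], from which [binv a] removes [a]. *)
  rewrite -[in RHS](soc_binv sa) -bmulUK binv_unit /local_unit -addA.
  rewrite (proj1 (sa _)) mulA bmulVl bmul_unit addA.
  by rewrite (local_unitKV addC).
transitivity (- a + (b + a) + - a).
  rewrite addA -[RHS]addA -/(a⁰) -(local_unitC addC) addA.
  by rewrite (local_unitKV addC).
rewrite -(proj2 (sa b)) addA (mulVl addC) (local_unitC addC) -addA.
by rewrite (local_unitKV addC).
Qed.

Lemma lambda_soc a z : Soc S z -> lambda a z = a ∘ z ∘ binv a.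
Proof.
by move=> sz; rewrite lambda_bmul -(proj2 (sz _)) (proj1 (sz _)) mulA.
Qed.

Lemma lambda_soc_add a z : Soc S z -> lambda a z = a ∘ z + - a.
Proof.
move=> sz; rewrite lambda_bmul -(proj2 (sz _)) bmulDr bmul_div.
by rewrite -addA -(local_unitC addC) (local_unitKV addC).
Qed.

Lemma lambda_unitK a b : lambda a b + a⁰ = lambda a b.
Proof.
by rewrite -(local_unitC addC) /lambda addA (local_unitKV addC).
Qed.

Lemma soc_lambda a z : Soc S z -> Soc S (lambda a z).
Proof.
move=> sz b; split.
  (* As [z] acts additively on [binv a ∘ b], the product is [a ∘ (z + binv a ∘ b)], which expands to
     [a ∘ z + - a + (a⁰ + b)]. *)
  rewrite {2}lambda_soc // -!mulA -(proj1 (sz _)) bmulDr mulA bmul_div.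
  by rewrite -lambda_soc_add // bmul_unit addA lambda_unitK.
(* Centrality is transported from [z + d = d + z] by the additive map [lambda a], whose image
   contains [b] up to the unit [a⁰]. *)
have [d dE] : exists d, lambda a d = a⁰ + b.
  exists (binv a ∘ (a + b)); rewrite /lambda mulA bmul_div bmul_unit.
  by rewrite (addA a⁰) (local_unitK addC) addA (mulVl addC).
rewrite -{1}lambda_unitK -addA -dE -lambdaD (proj2 (sz d)) lambdaD dE.
by rewrite (local_unitC addC) -addA (local_unitC addC) lambda_unitK.
Qed.

Lemma soc_add_comm a b : Soc S (a + b) -> Soc S (b + a).
Proof.
move=> sz; suff -> : b + a = a + b by [].
(* [b + a] is a conjugate of [a + b], and a central element is unchanged by conjugation once the
   local unit is absorbed. *)
transitivity (- a + (a + b) + a).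
  by rewrite addA (mulVl addC) (local_unitC addC) -addA (local_unitK addC).
rewrite -(proj2 (sz _)) -addA (mulVl addC) -(local_unitC addC).
by rewrite addA (local_unitK addC).
Qed.

Lemma soc_mul_comm a b : Soc S (a ∘ b) -> Soc S (b ∘ a).
Proof.
move=> sz; suff -> : b ∘ a = lambda (binv a) (a ∘ b) by exact: soc_lambda.
rewrite lambda_soc // (inv_inv mulI) mulA bmulVl -bmul_div.
by rewrite (local_unitC mulC) -mulA (local_unitK mulC).
Qed.
End Socle.

Theorem proposition23 (S : dualWeakBrace) : is_ideal (Soc S).
Proof.
split.
- split.
  + by move=> e; exact: soc_idem.
  + exact: soc_opp.
  + move=> a b sa sb.
    (* Only [a⁰ + b] is known to be in the socle, so [a + b] is rewritten as [a + (a⁰ + b)]. *)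
    rewrite -(local_unitK (badd_clifford S) a).
    rewrite (local_unitC (badd_clifford S)) -(op_assoc (badd_inverse S)).
    exact: soc_add.
  + exact: soc_add_comm.
- by move=> a _ [z sz <-]; exact: soc_lambda.
- split.
  + by move=> e /idem_add_of_mul; exact: soc_idem.
  + by move=> a sa; rewrite soc_binv //; exact: soc_opp.
  + move=> a b sa; rewrite /local_unit bmul_div bmul_unit => sb.
    by rewrite -bmulUK -(proj1 (sa _)); exact: soc_add.
  + exact: soc_mul_comm.
Qed.
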